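(* For every Gödel set $V$, the set of sentences of the Bernays–Schönfinkel class (w.r.t. 1-satisfiability) that are 1-satisfiable in $G_V$ is decidable.
   Context: A Gödel set is a closed set $V\subseteq[0,1]$ with $0,1\in V$. A $V$-interpretation assigns to each $k$-ary predicate a function $U^k\to V$ on a nonempty domain $U$ (constants as usual); $\bot\mapsto0$, $\wedge,\vee$ are $\min,\max$, $\mathcal I(A\supset B)=1$ if $\mathcal I(A)\le\mathcal I(B)$ and $=\mathcal I(B)$ otherwise, $\forall,\exists$ are $\inf,\sup$ over $U$. A sentence is 1-satisfiable in $G_V$ if some $V$-interpretation gives it value $1$. The Bernays–Schönfinkel (BS) class w.r.t. 1-satisfiability consists of sentences $\exists\bar x\,\forall\bar y\,\psi(\bar x,\bar y)$ with $\psi$ quantifier-free, $\bar x,\bar y$ possibly empty tuples of variables, over a signature with no function symbols of positive arity (only constants and predicate symbols). *)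

(* Defs.v *)
From HB Require Import structures.
From mathcomp Require Import all_boot all_order all_algebra.
From mathcomp Require Import all_classical all_reals topology normedtype.
From mathcomp Require Import Rstruct Rstruct_topology.
From Stdlib Require Rdefinitions.
Notation R := Rdefinitions.R.

Set Implicit Arguments.
Unset Strict Implicit.
Unset Printing Implicit Defensive.
Import Order.TTheory GRing.Theory Num.Theory.
Local Open Scope classical_set_scope.
Local Open Scope ring_scope.

Definition goedel_set (V : set R) : Prop :=
  closed V /\ V `<=` [set x : R | 0 <= x <= 1] /\ V 0 /\ V 1.

Inductive term : Type :=
| TVar : nat -> term
| TConst : nat -> term.

(* Formulas. [Atom p ts] applies the predicate symbol named p to the terms
   ts; the arity of the symbol is size ts, so the predicate symbols are the
   pairs (p, k) with k the arity. *)
Inductive formula : Type :=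
| FBot : formula
| Atom : nat -> seq term -> formula
| FAnd : formula -> formula -> formula
| FOr  : formula -> formula -> formula
| FImp : formula -> formula -> formula
| FAll : nat -> formula -> formula
| FEx  : nat -> formula -> formula.

Definition term_fv (t : term) : seq nat :=
  match t with TVar x => [:: x] | TConst _ => [::] end.

Fixpoint fv (A : formula) : seq nat :=
  match A with
  | FBot => [::]
  | Atom _ ts => flatten (map term_fv ts)
  | FAnd A B | FOr A B | FImp A B => fv A ++ fv B
  | FAll x A | FEx x A => seq.filter (fun y => y != x) (fv A)
  end.

Definition sentence (A : formula) : Prop := fv A = [::].

Fixpoint qfree (A : formula) : Prop :=
  match A with
  | FBot | Atom _ _ => True
  | FAnd A B | FOr A B | FImp A B => qfree A /\ qfree B
  | FAll _ _ | FEx _ _ => False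
  end.

Definition exs (xs : seq nat) (A : formula) : formula := foldr FEx A xs.
Definition alls (ys : seq nat) (A : formula) : formula := foldr FAll A ys.

Definition BS (A : formula) : Prop :=
  sentence A /\ exists xs ys psi, qfree psi /\ A = exs xs (alls ys psi).

Definition gimp (a b : R) : R := if a <= b then 1 else b.

Definition upd (U : Type) (e : nat -> U) (x : nat) (u : U) : nat -> U :=
  fun y => if y == x then u else e y.

Section Eval.
Variables (U : Type) (cst : nat -> U) (prd : nat -> seq U -> R).

Definition teval (e : nat -> U) (t : term) : U :=
  match t with TVar x => e x | TConst c => cst c end.

Fixpoint feval (e : nat -> U) (A : formula) : R :=
  match A with
  | FBot => 0
  | Atom p ts => prd p (map (teval e) ts)
  | FAnd A B => Num.min (feval e A) (feval e B)
  | FOr A B => Num.max (feval e A) (feval e B)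
  | FImp A B => gimp (feval e A) (feval e B)
  | FAll x A => inf [set feval (upd e x u) A | u in [set: U]]
  | FEx x A => sup [set feval (upd e x u) A | u in [set: U]]
  end.
End Eval.

(* A sentence is 1-satisfiable in G_V if some V-interpretation (nonempty
   domain U, constants interpreted in U, each k-ary predicate interpreted as
   a function U^k -> V) gives it value 1. The valuation is irrelevant for
   sentences; we use the constant one at the witness u0. *)
Definition one_sat (V : set R) (A : formula) : Prop :=
  exists (U : Type) (u0 : U) (cst : nat -> U) (prd : nat -> seq U -> R),
    (forall p (us : seq U), V (prd p us)) /\
    feval cst prd (fun _ => u0) A = 1.

Local Close Scope ring_scope.

Definition npair (a b : nat) : nat := ((a + b) * (a + b).+1) %/ 2 + b.

Definition enc_term (t : term) : nat :=
  match t with TVar x => x.*2 | TConst c => c.*2.+1 end.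

Fixpoint enc_terms (ts : seq term) : nat :=
  match ts with [::] => 0 | t :: ts => (npair (enc_term t) (enc_terms ts)).+1 end.

Fixpoint enc (A : formula) : nat :=
  match A with
  | FBot => 0
  | Atom p ts => (6 * npair p (enc_terms ts)).+1
  | FAnd A B => (6 * npair (enc A) (enc B)).+2
  | FOr A B => (6 * npair (enc A) (enc B)).+3
  | FImp A B => (6 * npair (enc A) (enc B)).+4
  | FAll x A => (6 * npair x (enc A)).+4.+1
  | FEx x A => (6 * npair x (enc A)).+4.+2
  end.

Inductive rcode : Type :=
| RZero : rcode
| RSucc : rcode
| RProj : nat -> rcode
| RComp : rcode -> seq rcode -> rcode
| RRec  : rcode -> rcode -> rcode
| RMu   : rcode -> rcode.

Inductive reval : rcode -> seq nat -> nat -> Prop :=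
| reval_zero v : reval RZero v 0
| reval_succ x v : reval RSucc (x :: v) x.+1
| reval_proj i v : i < size v -> reval (RProj i) v (nth 0 v i)
| reval_comp f gs v ws y :
    revals gs v ws -> reval f ws y -> reval (RComp f gs) v y
| reval_rec0 f g v y : reval f v y -> reval (RRec f g) (0 :: v) y
| reval_recS f g n v r y :
    reval (RRec f g) (n :: v) r -> reval g (n :: r :: v) y ->
    reval (RRec f g) (n.+1 :: v) y
| reval_mu f v n :
    reval f (n :: v) 0 ->
    (forall m, m < n -> exists k, reval f (m :: v) k.+1) ->
    reval (RMu f) v n
with revals : seq rcode -> seq nat -> seq nat -> Prop :=
| revals_nil v : revals [::] v [::]
| revals_cons g gs v w ws :
    reval g v w -> revals gs v ws -> revals (g :: gs) v (w :: ws).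

Definition decidable_nat (P : nat -> Prop) : Prop :=
  exists c : rcode, forall n : nat,
    (P n -> reval c [:: n] 1) /\ (~ P n -> reval c [:: n] 0).

(* Main.v *)
Require Import Defs.
From mathcomp Require Import all_boot all_order all_algebra.
From mathcomp Require Import all_classical all_reals.
From mathcomp Require Import Rstruct Rstruct_topology.
From mathcomp Require Import zify.

(* Sending 0 to 0 and every positive truth value to 1 commutes with the propositional
   connectives, and if a sentence of the form "exists xs, forall ys, psi" has positive
   value, then some values of xs give psi a positive value for all ys. So 1-satisfiability
   in G_V is classical satisfiability, whatever V is. Since the signature has
   neither equality nor functions, a classical model can be pulled back to
   the finite domain consisting of the constants and of the variables xs (read as Skolem
   constants). Formulas being numbers, there is thus a computable bound on the codes of
   the valuations of ground atoms and of the assignments to ys to be examined. *)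

Set Implicit Arguments.
Unset Strict Implicit.
Unset Printing Implicit Defensive.
Import Order.TTheory GRing.Theory Num.Theory.

(** * Computable functions *)

(* Quantifying over every arity [k] makes [nth 0 v i] computable with no bound on [i]. *)
Definition computable (f : seq nat -> nat) : Prop :=
  forall k, exists c, forall v, size v = k -> reval c v (f v).

Lemma computable_ext f g : (forall v, f v = g v) -> computable g -> computable f.
Proof. by move=> fg cg k; have [c H] := cg k; exists c => v /H; rewrite fg. Qed.

Lemma computable_const n : computable (fun _ => n).
Proof.
elim: n => [|n IH] k; first by exists RZero => v _; constructor.
have [c H] := IH k; exists (RComp RSucc [:: c]) => v sv.
by apply: (@reval_comp _ _ _ [:: n]); repeat constructor; exact: H.
Qed.

Lemma computable_nth i : computable (nth 0 ^~ i).
Proof.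
move=> k; have [lt_ik|le_ki] := ltnP i k.
  by exists (RProj i) => v sv; constructor; rewrite sv.
by exists RZero => v sv; rewrite nth_default ?sv //; constructor.
Qed.

Fixpoint all_computable (gs : seq (seq nat -> nat)) : Prop :=
  if gs is g :: gs' then computable g /\ all_computable gs' else True.

Lemma revals_cat cs ds v xs ys :
  revals cs v xs -> revals ds v ys -> revals (cs ++ ds) v (xs ++ ys).
Proof.
elim: cs xs => [|c cs IH] xs H Hd; first by inversion H.
by inversion H; subst; constructor=> //; apply: IH.
Qed.

Lemma revals_drop d v :
  revals (map RProj (iota d (size v - d))) v (drop d v).
Proof.
have [|le_vd] := ltnP d (size v); last first.
  by rewrite drop_oversize // (eqP le_vd); constructor.
move=> /ltnW le_dv; move sE: (size v - d) => s.
elim: s d le_dv sE => [|s IH] d le_dv sE.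
  by rewrite drop_oversize; [constructor|lia].
rewrite /= (drop_nth 0); last by lia.
by constructor; [constructor; lia | apply: IH; lia].
Qed.

(** Composition in the style of de Bruijn indices: the results of [gs] replace the first [d]
    entries, and the remaining ones are passed on by projections. *)
Lemma computable_subst d gs f : computable f -> all_computable gs ->
  computable (fun v => f ([seq g v | g <- gs] ++ drop d v)).
Proof.
move=> cf cgs k.
have [cs Hcs] : exists cs, forall v, size v = k -> revals cs v [seq g v | g <- gs].
  elim: gs cgs => [_|g gs IH /= [cg /IH[cs H]]].
    by exists [::] => v _; constructor.
  have [c Hc] := cg k; exists (c :: cs) => v sv.
  by constructor; [exact: Hc | exact: H].
have [c Hc] := cf (size gs + (k - d)).
exists (RComp c (cs ++ map RProj (iota d (k - d)))) => v sv.
apply: (reval_comp (ws := [seq g v | g <- gs] ++ drop d v)).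
  by apply: revals_cat; [exact: Hcs | rewrite -sv; exact: revals_drop].
by apply: Hc; rewrite size_cat size_map size_drop sv.
Qed.

Lemma computable_drop d f : computable f -> computable (fun v => f (drop d v)).
Proof. by move=> cf; exact: (@computable_subst d [::]). Qed.

Lemma computable_succ a : computable a -> computable (fun v => (a v).+1).
Proof.
move=> ca k; have [c Hc] := ca k.
exists (RComp RSucc [:: c]) => v sv.
by apply: (@reval_comp _ _ _ [:: a v]); repeat constructor; exact: Hc.
Qed.

(** In the premise on [g] the list [w] acts as a context: entry 0 is the counter, entry 1 the
    previous value, the tail the parameters. Later binding constructs put their bound variables in
    front in the same way. *)
Lemma computable_rec a f g : computable a -> computable f ->
  computable (fun w => g (nth 0 w 0) (nth 0 w 1) (drop 2 w)) ->
  computable (fun v => nat_rect (fun=> nat) (f v) (fun n r => g n r v) (a v)).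
Proof.
move=> ca cf cg k.
have [cf' Hf] := cf k; have [cg' Hg] := cg k.+2; have [ca' Ha] := ca k.
exists (RComp (RRec cf' cg') (ca' :: map RProj (iota 0 k))) => v sv.
apply: (reval_comp (ws := a v :: v)).
  constructor; first exact: Ha.
  by rewrite -sv -{1}(subn0 (size v)) -{3}(drop0 v); exact: revals_drop.
elim: (a v) => [|n IH] /=; first by constructor; exact: Hf.
apply: reval_recS IH _.
have := Hg (n :: nat_rect (fun=> nat) (f v) (fun n r => g n r v) n :: v).
by rewrite /= drop0; apply; rewrite sv.
Qed.

(** * Arithmetic, Boolean operations and bounded search *)

Lemma computable_add a b : computable a -> computable b -> computable (fun v => a v + b v).
Proof.
move=> ca cb.
apply: (@computable_ext _ (fun v => nat_rect (fun=> nat) (b v) (fun _ r => r.+1) (a v))).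
  by move=> v; elim: (a v) => //= n <-.
apply: computable_rec => //; apply: computable_succ; exact: computable_nth.
Qed.

Lemma computable_pred a : computable a -> computable (fun v => (a v).-1).
Proof.
move=> ca.
apply: (@computable_ext _ (fun v => nat_rect (fun=> nat) 0 (fun n _ => n) (a v))).
  by move=> v; case: (a v).
apply: computable_rec => //; [exact: computable_const | exact: computable_nth].
Qed.

Lemma computable_sub a b : computable a -> computable b -> computable (fun v => a v - b v).
Proof.
move=> ca cb.
apply: (@computable_ext _ (fun v => nat_rect (fun=> nat) (a v) (fun _ r => r.-1) (b v))).
  by move=> v; elim: (b v) => /= [|n <-]; rewrite ?subn0 ?subnS.
apply: computable_rec => //; apply: computable_pred; exact: computable_nth.
Qed.

Lemma computable_mul a b : computable a -> computable b -> computable (fun v => a v * b v).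
Proof.
move=> ca cb.
apply: (@computable_ext _ (fun v => nat_rect (fun=> nat) 0 (fun _ r => b v + r) (a v))).
  by move=> v; elim: (a v) => //= n <-.
apply: computable_rec => //; first exact: computable_const.
by apply: computable_add; [apply: computable_drop | exact: computable_nth].
Qed.

Lemma computable_negb (p : seq nat -> bool) : computable p -> computable (fun v => ~~ p v).
Proof.
move=> cp; apply: (@computable_ext _ (fun v => 1 - p v)); first by move=> v; case: (p v).
by apply: computable_sub; first exact: computable_const.
Qed.

Lemma computable_andb (p q : seq nat -> bool) :
  computable p -> computable q -> computable (fun v => p v && q v).
Proof.
move=> cp cq; apply: (@computable_ext _ (fun v => p v * q v)); last exact: computable_mul.
by move=> v; rewrite mulnb.
Qed.

Lemma computable_orb (p q : seq nat -> bool) :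
  computable p -> computable q -> computable (fun v => p v || q v).
Proof.
move=> cp cq; apply: (@computable_ext _ (fun v => ~~ (~~ p v && ~~ q v))).
  by move=> v; rewrite negb_and !negbK.
by apply: computable_negb; apply: computable_andb; apply: computable_negb.
Qed.

Lemma computable_implb (p q : seq nat -> bool) :
  computable p -> computable q -> computable (fun v => p v ==> q v).
Proof.
move=> cp cq; apply: (@computable_ext _ (fun v => ~~ p v || q v)).
  by move=> v; rewrite implybE.
by apply: computable_orb => //; apply: computable_negb.
Qed.

Lemma computable_leq a b : computable a -> computable b -> computable (fun v => a v <= b v).
Proof.
move=> ca cb; apply: (@computable_ext _ (fun v => 1 - (a v - b v))).
  by move=> v; lia.
by apply: computable_sub; [exact: computable_const | exact: computable_sub].
Qed.

Lemma computable_eqn a b : computable a -> computable b -> computable (fun v => a v == b v).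
Proof.
move=> ca cb; apply: (@computable_ext _ (fun v => (a v <= b v) && (b v <= a v))).
  by move=> v; rewrite eqn_leq.
by apply: computable_andb; apply: computable_leq.
Qed.

Lemma computable_if (p : seq nat -> bool) a b : computable p -> computable a -> computable b ->
  computable (fun v => if p v then a v else b v).
Proof.
move=> cp ca cb; apply: (@computable_ext _ (fun v => p v * a v + (~~ p v) * b v)).
  by move=> v; case: (p v); rewrite ?mul1n ?mul0n ?addn0.
by apply: computable_add; apply: computable_mul => //; apply: computable_negb.
Qed.

Lemma computable_ifb (p a b : seq nat -> bool) : computable p -> computable a -> computable b ->
  computable (fun v => if p v then a v else b v).
Proof.
move=> cp ca cb; apply: (@computable_ext _ (fun v => if p v then a v : nat else b v)).
  by move=> v; case: (p v).
exact: computable_if.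
Qed.

Lemma computable_minn a b :
  computable a -> computable b -> computable (fun v => minn (a v) (b v)).
Proof.
move=> ca cb; apply: (@computable_ext _ (fun v => a v - (a v - b v))).
  by move=> v; lia.
by do 2 apply: computable_sub => //.
Qed.

Lemma computable_has a (p : nat -> seq nat -> bool) : computable a ->
  computable (fun w => p (nth 0 w 0) (drop 1 w)) ->
  computable (fun v => has (p ^~ v) (iota 0 (a v))).
Proof.
move=> ca cp.
apply: (@computable_ext _ (fun v => nat_rect (fun=> nat) 0
    (fun n r => (0 < r) || p n v) (a v))).
  move=> v; elim: (a v) => // n IH.
  by rewrite -{1}addn1 iotaD has_cat /= orbF -IH; case: has.
apply: computable_rec => //; first exact: computable_const.
apply: computable_orb; first by apply: computable_leq;
  [exact: computable_const | exact: computable_nth].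
(* The predicate does not see the accumulator, so the two leading entries are replaced by the
   counter alone. *)
apply: computable_ext (@computable_subst 2 [:: nth 0 ^~ 0] _ cp
  (conj (computable_nth 0) I)) => w.
by rewrite /= drop0.
Qed.

Lemma computable_all a (p : nat -> seq nat -> bool) : computable a ->
  computable (fun w => p (nth 0 w 0) (drop 1 w)) ->
  computable (fun v => all (p ^~ v) (iota 0 (a v))).
Proof.
move=> ca cp.
apply: (@computable_ext _ (fun v => ~~ has (fun i => ~~ p i v) (iota 0 (a v)))).
  by move=> v; rewrite has_predC negbK.
by apply: computable_negb; apply: computable_has => //; apply: computable_negb.
Qed.

(** Nested binders produce entries and tails of tails; this lemma and the next flatten them to forms
    that the tactic recognises. *)
Lemma computable_nth_drop d i (f : seq nat -> seq nat) :
  computable (fun v => nth 0 (f v) (d + i)) ->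
  computable (fun v => nth 0 (drop d (f v)) i).
Proof. by apply: computable_ext => v; rewrite nth_drop. Qed.

Lemma computable_drop_drop d e x (f : seq nat -> seq nat) :
  computable (fun v => x (drop (d + e) (f v))) ->
  computable (fun v => x (drop d (drop e (f v)))).
Proof. by apply: computable_ext => v; rewrite drop_drop. Qed.

Ltac computability_step :=
  first [ assumption
        | simple apply computable_const
        | simple apply computable_nth
        | simple apply computable_nth_drop
        | simple apply computable_drop_drop
        | simple apply computable_succ
        | simple apply computable_add
        | simple apply computable_pred
        | simple apply computable_sub
        | simple apply computable_mul
        | simple apply computable_negb
        | simple apply computable_andb
        | simple apply computable_orb
        | simple apply computable_implb
        | simple apply computable_leq
        | simple apply computable_eqn
        | simple apply computable_ifb
        | simple apply computable_if
        | simple apply computable_minn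
        | match goal with |- computable (fun w => ?x (drop ?d w)) =>
             simple apply (@computable_drop d x); assumption end ].

(** The remainder is a counter that returns to 0 on reaching [b v]; when [b v] is 0 it never does,
    in agreement with [n %% 0 = n]. *)
Lemma computable_mod a b :
  computable a -> computable b -> computable (fun v => a v %% b v).
Proof.
move=> ca cb; apply: (@computable_ext _ (fun v => nat_rect (fun=> nat) 0
    (fun _ r => if r.+1 == b v then 0 else r.+1) (a v))).
  move=> v; elim: (a v) => [|n IH] /=; first by rewrite mod0n.
  rewrite -IH modnS {1}(divn_eq n (b v)) -addnS dvdn_addr ?dvdn_mull //.
  have [->|b_gt0] := posnP (b v); first by [].
  have := ltn_pmod n b_gt0; rewrite leq_eqVlt => /orP[/eqP ->|lt_b].
    by rewrite dvdnn eqxx.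
  by rewrite gtnNdvd // (ltn_eqF lt_b).
apply: computable_rec; repeat computability_step.
Qed.

(** For a positive divisor the quotient counts the multiples of [b v] among [1, ..., a v]. *)
Lemma computable_div a b :
  computable a -> computable b -> computable (fun v => a v %/ b v).
Proof.
move=> ca cb; apply: (@computable_ext _ (fun v => nat_rect (fun=> nat) 0
    (fun n r => if b v == 0 then 0 else (n.+1 %% b v == 0) + r) (a v))).
  move=> v; elim: (a v) => [|n IH] /=; first by rewrite div0n.
  by rewrite -IH; case: (posnP (b v)) => [->|b_gt0]; rewrite ?divn0 // divnS.
apply: computable_rec; repeat first [computability_step | simple apply computable_mod].
Qed.

(** * Cantor pairing and codes of lists *)

Lemma computable_npair a b :
  computable a -> computable b -> computable (fun v => npair (a v) (b v)).
Proof.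
move=> ca cb; rewrite /npair.
by repeat first [computability_step | simple apply computable_div].
Qed.

(* [diag n] is the sum of the two components of the pair coded by [n]. *)
Definition diag (n : nat) : nat := nat_rect (fun=> nat) 0
  (fun k r => if npair r.+1 0 <= k.+1 then r.+1 else r) n.
Definition snd_of (n : nat) : nat := n - npair (diag n) 0.
Definition fst_of (n : nat) : nat := diag n - snd_of n.

(** [npair w 0] is the [w]-th triangular number, at which the [w]-th diagonal begins. *)
Lemma npairS w : npair w.+1 0 = npair w 0 + w.+1.
Proof.
rewrite /npair !addn0 (_ : w.+1 * w.+2 = w.+1 * 2 + w * w.+1); last by lia.
by rewrite divnMDl // addnC.
Qed.

Lemma npair_diag a b : npair a b = npair (a + b) 0 + b.
Proof. by rewrite /npair !addn0. Qed.

Lemma diag_bounds n : npair (diag n) 0 <= n < npair (diag n).+1 0.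
Proof.
elim: n => // n /andP[lo hi]; rewrite [diag n.+1]/= -/(diag n).
by have := npairS (diag n).+1; case: (leqP (npair (diag n).+1 0) n.+1); lia.
Qed.

Lemma npair0_mono w w' : w <= w' -> npair w 0 <= npair w' 0.
Proof.
by elim: w' => [|w' IH]; rewrite leq_eqVlt => /predU1P[->//|] // /IH; rewrite npairS; lia.
Qed.

Lemma diag_npair a b : diag (npair a b) = a + b.
Proof.
have /andP[lo hi] := diag_bounds (npair a b).
have := npairS (a + b); have := npair_diag a b.
move: (diag _) lo hi => d lo hi eab eS.
have [ltd|ltd|//] := ltngtP d (a + b).
  by have := @npair0_mono d.+1 (a + b) ltd; lia.
by have := @npair0_mono (a + b).+1 d ltd; lia.
Qed.

Lemma snd_npair a b : snd_of (npair a b) = b.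
Proof. by rewrite /snd_of diag_npair npair_diag addKn. Qed.

Lemma fst_npair a b : fst_of (npair a b) = a.
Proof. by rewrite /fst_of snd_npair diag_npair addnK. Qed.

Lemma npair_fst_snd n : npair (fst_of n) (snd_of n) = n.
Proof.
have /andP[lo hi] := diag_bounds n; have e := npairS (diag n).
by rewrite npair_diag /fst_of /snd_of subnK ?subnKC //; lia.
Qed.

Lemma npair_ge0 w : w <= npair w 0.
Proof. by elim: w => // w; rewrite npairS; lia. Qed.

Lemma npair_ge a b : a <= npair a b /\ b <= npair a b.
Proof. by rewrite npair_diag; have := npair_ge0 (a + b); lia. Qed.

Lemma leq_npair a b a' b' : a <= a' -> b <= b' -> npair a b <= npair a' b'.
Proof.
move=> la lb; rewrite (npair_diag a) (npair_diag a').
by have := @npair0_mono (a + b) (a' + b'); lia.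
Qed.

Lemma computable_diag a : computable a -> computable (fun v => diag (a v)).
Proof.
move=> ca; apply: computable_rec => //; first exact: computable_const.
by repeat first [computability_step | simple apply computable_npair].
Qed.

Lemma computable_snd_of a : computable a -> computable (fun v => snd_of (a v)).
Proof.
move=> ca; apply: computable_sub => //; apply: computable_npair; last exact: computable_const.
exact: computable_diag.
Qed.

Lemma computable_fst_of a : computable a -> computable (fun v => fst_of (a v)).
Proof.
by move=> ca; apply: computable_sub; [exact: computable_diag | exact: computable_snd_of].
Qed.

Definition lcode (s : seq nat) : nat := foldr (fun x c => (npair x c).+1) 0 s.

(** The predecessor undoes the successor by which a nonempty list differs from the empty one, coded
    by 0. *)
Definition lnth (c i : nat) : nat := fst_of (iter i (fun d => snd_of d.-1) c).-1.

Lemma lnth_lcode s i : i < size s -> lnth (lcode s) i = nth 0 s i.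
Proof.
rewrite /lnth; elim: s i => // x s IH [|i]; first by rewrite /= fst_npair.
by move=> lt_is; rewrite iterSr /= snd_npair; exact: IH.
Qed.

Lemma computable_lnth a b :
  computable a -> computable b -> computable (fun v => lnth (a v) (b v)).
Proof.
move=> ca cb; apply: computable_fst_of; apply: computable_pred.
apply: (@computable_ext _ (fun v => nat_rect (fun=> nat) (a v) (fun _ r => snd_of r.-1) (b v))).
  by move=> v; elim: (b v) => //= n ->.
apply: computable_rec => //; apply: computable_snd_of; apply: computable_pred.
exact: computable_nth.
Qed.

(** This is the code of the list of [n] copies of [K]. *)
Fixpoint lcode_max (K n : nat) : nat :=
  if n is n'.+1 then (npair K (lcode_max K n')).+1 else 0.

Lemma lcode_bound K n s :
  size s <= n -> all (fun x => x <= K) s -> lcode s <= lcode_max K n.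
Proof.
elim: n s => [|n IH] [|x s] //= sn /andP[xK sK].
by rewrite ltnS leq_npair // IH.
Qed.

Lemma computable_lcode_max a b :
  computable a -> computable b -> computable (fun v => lcode_max (a v) (b v)).
Proof.
move=> ca cb.
apply: (@computable_ext _ (fun v => nat_rect (fun=> nat) 0
    (fun _ r => (npair (a v) r).+1) (b v))).
  by move=> v; elim: (b v) => //= n ->.
by apply: computable_rec => //; repeat first [computability_step | simple apply computable_npair].
Qed.

Ltac computability_with op := repeat (cbv beta; first [ computability_step
  | simple apply computable_mod | simple apply computable_div
  | simple apply computable_npair | simple apply computable_fst_of
  | simple apply computable_snd_of | simple apply computable_lnth
  | simple apply computable_lcode_max | op ]).
Ltac computability := computability_with fail.

(* Course-of-values recursion: [G n h] may consult the values at all [i < n] by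
   [look h n i]; the history [h] is the list code of these values, latest first. *)
Definition history (G : nat -> nat -> nat) (n : nat) : nat :=
  nat_rect (fun=> nat) 0 (fun k h => (npair (G k h) h).+1) n.
Definition cov (G : nat -> nat -> nat) (n : nat) : nat := G n (history G n).
Definition look (h n i : nat) : nat := lnth h (n - i.+1).

Lemma look_history G n i : i < n -> look (history G n) n i = cov G i.
Proof.
have hE m : history G m = lcode (rev (mkseq (cov G) m)).
  elim: m => // m IH; rewrite /mkseq -addn1 iotaD map_cat rev_cat /=.
  by rewrite /cov -/(history G m) -/(mkseq _ _) -IH addn1.
move=> lt_in; rewrite /look hE lnth_lcode ?size_rev ?size_mkseq; last by lia.
rewrite nth_rev size_mkseq ?nth_mkseq; try lia.
by congr cov; lia.
Qed.

Lemma computable_cov (G : seq nat -> nat -> nat -> nat) a : computable a ->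
  computable (fun w => G (drop 2 w) (nth 0 w 0) (nth 0 w 1)) ->
  computable (fun v => cov (G v) (a v)).
Proof.
move=> ca cG.
have ch : computable (fun v => history (G v) (a v)).
  apply: computable_rec => //; first exact: computable_const.
  by computability.
apply: computable_ext (@computable_subst 0 [:: a; fun v => history (G v) (a v)] _ cG _) => //.
by move=> v; rewrite /= !drop0.
Qed.

(* The argument [tag] is [6] for [FBot] and otherwise the residue by which [enc]
   distinguishes the other constructors. *)
Definition ftag (n : nat) : nat := if n == 0 then 6 else n.-1 %% 6.
Definition farg1 (n : nat) : nat := fst_of (n.-1 %/ 6).
Definition farg2 (n : nat) : nat := snd_of (n.-1 %/ 6).

(** Both arguments are looked up even when one is a variable, a predicate name or a list code; the
    functions [g] used below ignore such values. *)
Definition frec (g : nat -> nat -> nat -> nat -> nat -> nat) : nat -> nat :=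
  cov (fun n h => g (ftag n) (farg1 n) (farg2 n)
                    (look h n (farg1 n)) (look h n (farg2 n))).

Lemma computable_frec (g : seq nat -> nat -> nat -> nat -> nat -> nat -> nat) a : computable a ->
  computable (fun w => g (drop 5 w) (nth 0 w 0) (nth 0 w 1) (nth 0 w 2)
    (nth 0 w 3) (nth 0 w 4)) ->
  computable (fun v => frec (g v) (a v)).
Proof.
move=> ca cg; apply: computable_cov => //.
pose l i (w : seq nat) := look (nth 0 w 1) (nth 0 w 0) (i (nth 0 w 0)).
have [ct c1 c2] : [/\ computable (fun w => ftag (nth 0 w 0)),
    computable (fun w => farg1 (nth 0 w 0))
    & computable (fun w => farg2 (nth 0 w 0))].
  by split; rewrite /ftag /farg1 /farg2; computability.
apply: computable_ext (@computable_subst 2 [:: fun w => ftag (nth 0 w 0);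
    fun w => farg1 (nth 0 w 0); fun w => farg2 (nth 0 w 0); l farg1; l farg2] _ cg _).
  by move=> w; rewrite /= !drop0.
by rewrite /= /l /look; do !split => //; computability.
Qed.

(** Ensures that both recursive lookups fall within the history. *)
Lemma farg_lt n : 0 < n -> farg1 n < n /\ farg2 n < n.
Proof.
case: n => // n _; rewrite /farg1 /farg2 /=.
have := npair_ge (fst_of (n %/ 6)) (snd_of (n %/ 6)).
by rewrite npair_fst_snd; have := leq_div n 6; lia.
Qed.

Lemma frecE g n : 0 < n ->
  frec g n = g (ftag n) (farg1 n) (farg2 n) (frec g (farg1 n)) (frec g (farg2 n)).
Proof.
by move=> /farg_lt[lt1 lt2]; rewrite {1}/frec /cov !look_history.
Qed.

Lemma ftagE r a b : r < 6 -> ftag (6 * npair a b + r).+1 = r.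
Proof. by move=> r6; rewrite /ftag /= mulnC modnMDl modn_small. Qed.

Lemma farg1E r a b : r < 6 -> farg1 (6 * npair a b + r).+1 = a.
Proof. by move=> r6; rewrite /farg1 /= mulnC divnMDl // divn_small // addn0 fst_npair. Qed.

Lemma farg2E r a b : r < 6 -> farg2 (6 * npair a b + r).+1 = b.
Proof. by move=> r6; rewrite /farg2 /= mulnC divnMDl // divn_small // addn0 snd_npair. Qed.

Lemma frec_code g r a b : r < 6 ->
  frec g (6 * npair a b + r).+1 = g r a b (frec g a) (frec g b).
Proof. by move=> r6; rewrite frecE // ftagE ?farg1E ?farg2E. Qed.

Definition lrec (g : nat -> nat -> nat) : nat -> nat :=
  cov (fun n h => if n == 0 then 0 else g (fst_of n.-1) (look h n (snd_of n.-1))).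

Lemma lrec_lcode g s : lrec g (lcode s) = foldr g 0 s.
Proof.
elim: s => //= x s IH; rewrite {1}/lrec /cov look_history.
  by rewrite /= fst_npair snd_npair -/(lrec g) IH.
by rewrite /= snd_npair; have := npair_ge x (lcode s); lia.
Qed.

Lemma computable_lrec (g : seq nat -> nat -> nat -> nat) a : computable a ->
  computable (fun w => g (drop 2 w) (nth 0 w 0) (nth 0 w 1)) ->
  computable (fun v => lrec (g v) (a v)).
Proof.
move=> ca cg; apply: computable_cov => //; apply: computable_if; [by computability.. |].
apply: computable_ext (@computable_subst 2 [:: fun w => fst_of (nth 0 w 0).-1;
    fun w => look (nth 0 w 1) (nth 0 w 0) (snd_of (nth 0 w 0).-1)] _ cg _).
  by move=> w; rewrite /= !drop0.
by rewrite /= /look; do !split => //; computability.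
Qed.

(** * Deciding BS sentences by their codes *)

Lemma enc_termsE ts : enc_terms ts = lcode (map enc_term ts).
Proof. by elim: ts => //= t ts ->. Qed.

Lemma frec_enc g A : frec g (enc A) =
  match A with
  | FBot => g 6 0 0 0 0
  | Atom p ts => g 0 p (enc_terms ts) (frec g p) (frec g (enc_terms ts))
  | FAnd B C => g 1 (enc B) (enc C) (frec g (enc B)) (frec g (enc C))
  | FOr B C => g 2 (enc B) (enc C) (frec g (enc B)) (frec g (enc C))
  | FImp B C => g 3 (enc B) (enc C) (frec g (enc B)) (frec g (enc C))
  | FAll x B => g 4 x (enc B) (frec g x) (frec g (enc B))
  | FEx x B => g 5 x (enc B) (frec g x) (frec g (enc B))
  end.
Proof.
by case: A => [|p ts|B C|B C|B C|x B|x B] //=; rewrite -frec_code // addnC.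
Qed.

Lemma enc_terms_surj q : exists ts, enc_terms ts = q.
Proof.
elim/ltn_ind: q => -[|q] IH; first by exists [::].
have le_q := npair_ge (fst_of q) (snd_of q); rewrite npair_fst_snd in le_q.
have [ts Ets] : exists ts, enc_terms ts = snd_of q by apply: IH; lia.
have [t Et] : exists t, enc_term t = fst_of q.
  exists (if odd (fst_of q) then TConst (fst_of q)./2 else TVar (fst_of q)./2).
  by case: ifP => /= odd_q; have := odd_double_half (fst_of q); rewrite odd_q; lia.
by exists (t :: ts); rewrite /= Et Ets npair_fst_snd.
Qed.

(** The remainder modulo 6 selects the constructor, and the components of the quotient are small
    enough for strong induction. Every input is thus the code of a formula. *)
Lemma enc_surj n : exists A, enc A = n.
Proof.
elim/ltn_ind: n => -[|n] IH; first by exists FBot.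
pose q := n %/ 6; have le_q := npair_ge (fst_of q) (snd_of q).
rewrite npair_fst_snd in le_q.
have q_le : q <= n by rewrite /q; lia.
have [A EA] : exists A, enc A = fst_of q by apply: IH; lia.
have [B EB] : exists A, enc A = snd_of q by apply: IH; lia.
have [ts Ets] := enc_terms_surj (snd_of q).
have : n = n %% 6 + 6 * npair (fst_of q) (snd_of q).
  by rewrite npair_fst_snd {1}(divn_eq n 6) -/q; lia.
have : n %% 6 < 6 by rewrite ltn_mod.
case: (n %% 6) => [|[|[|[|[|[|]]]]]] // _ ->.
- by exists (Atom (fst_of q) ts); rewrite /= Ets.
- by exists (FAnd A B); rewrite /= EA EB.
- by exists (FOr A B); rewrite /= EA EB.
- by exists (FImp A B); rewrite /= EA EB.
- by exists (FAll (fst_of q) B); rewrite /= EB.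
- by exists (FEx (fst_of q) B); rewrite /= EB.
Qed.

(* The greatest [l] such that the formula is: quantifier-free (3), a universal closure
   of such (2), an existential closure of the latter (1). *)
Fixpoint level (A : formula) : nat :=
  match A with
  | FBot | Atom _ _ => 3
  | FAnd B C | FOr B C | FImp B C => if (level B == 3) && (level C == 3) then 3 else 0
  | FAll _ B => if 2 <= level B then 2 else 0
  | FEx _ B => if 1 <= level B then 1 else 0
  end.

Definition level_code : nat -> nat := frec (fun t a b ra rb =>
  if (t == 6) || (t == 0) then 3
  else if t <= 3 then if (ra == 3) && (rb == 3) then 3 else 0
  else if t == 4 then if 2 <= rb then 2 else 0
  else if 1 <= rb then 1 else 0).

Lemma level_codeE A : level_code (enc A) = level A.
Proof.
rewrite /level_code; elim: A => [|p ts|B IHB C IHC|B IHB C IHC|B IHB C IHC|x B IH|x B IH];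
  by rewrite frec_enc /= ?IHB ?IHC ?IH.
Qed.

Lemma computable_level_code a : computable a -> computable (fun v => level_code (a v)).
Proof. by move=> ca; apply: computable_frec => //; computability. Qed.

Lemma level_qfree A : level A = 3 <-> qfree A.
Proof.
elim: A => [|p ts|B IHB C IHC|B IHB C IHC|B IHB C IHC|x B IH|x B IH] //=;
  try by (rewrite -IHB -IHC; split=> [|[-> ->] //]; case: ifP => // /andP[/eqP-> /eqP->]).
all: by split => //; case: ifP.
Qed.

Lemma level_alls A :
  2 <= level A <-> exists ys psi, qfree psi /\ A = alls ys psi.
Proof.
split=> [|[ys [psi [/level_qfree qf ->]]]]; last first.
  by elim: ys => [|y ys IH] /=; [rewrite qf | rewrite IH].
have base B : level B = 3 -> exists ys psi, qfree psi /\ B = alls ys psi.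
  by move=> /level_qfree qf; exists [::], B.
elim: A => [|p ts|B IHB C IHC|B IHB C IHC|B IHB C IHC|x B IH|x B IH] lv;
  try by (apply: base; move: lv => //=; case: ifP).
  by move: lv => /=; case: ifP => // /IH[ys [psi [qf ->]]] _; exists (x :: ys), psi.
Qed.

Lemma level_BS A :
  1 <= level A <-> exists xs ys psi, qfree psi /\ A = exs xs (alls ys psi).
Proof.
split=> [|[xs [ys [psi [qf ->]]]]]; last first.
  elim: xs => [|x xs IH] /=; last by rewrite IH.
  by apply: ltnW; apply/level_alls; exists ys, psi.
have base B : 2 <= level B -> exists xs ys psi, qfree psi /\ B = exs xs (alls ys psi).
  by move=> /level_alls[ys [psi [qf ->]]]; exists [::], ys, psi.
elim: A => [|p ts|B IHB C IHC|B IHB C IHC|B IHB C IHC|x B IH|x B IH] lv;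
  try by (apply: base; move: lv => //=; case: ifP).
by move: lv => /=; case: ifP => // /IH[xs [ys [psi [qf ->]]]] _; exists (x :: xs), ys, psi.
Qed.

(** The number [2 * x] is [enc_term (TVar x)]; constants have odd codes and never match it. *)
Definition free_code (x : nat) : nat -> nat := frec (fun t a b ra rb =>
  if t == 6 then false
  else if t == 0 then 0 < lrec (fun d r => (d == 2 * x) || (0 < r)) b
  else if t <= 3 then (0 < ra) || (0 < rb)
  else (a != x) && (0 < rb)).

Lemma free_codeE x A : free_code x (enc A) = (x \in fv A).
Proof.
have lrecE ts : lrec (fun d r => (d == 2 * x) || (0 < r)) (enc_terms ts)
    = (x \in flatten (map term_fv ts)).
  rewrite enc_termsE lrec_lcode; elim: ts => //= t ts ->.
  rewrite mem_cat; congr (nat_of_bool (_ || _)); last by case: (_ \in _).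
  by case: t => y; rewrite /= ?mem_seq1 ?in_nil; lia.
rewrite /free_code; elim: A => [|p ts|B IHB C IHC|B IHB C IHC|B IHB C IHC|y B IH|y B IH];
  by rewrite frec_enc /= ?lrecE ?IHB ?IHC ?IH ?lt0b ?mem_cat ?mem_filter // eq_sym.
Qed.

Lemma computable_free_code a b :
  computable a -> computable b -> computable (fun v => free_code (a v) (b v)).
Proof.
move=> ca cb; apply: computable_frec => //.
by computability_with ltac:(simple apply computable_lrec).
Qed.

(** In a BS prefix the universal quantifiers are the inner ones, so a variable quantified in both
    ways counts as universal. *)
Fixpoint univ_bound (x : nat) (A : formula) : bool :=
  match A with
  | FAll y B => (y == x) || univ_bound x B
  | FEx _ B => univ_bound x B
  | _ => false
  end.

Definition univ_code (x : nat) : nat -> nat := frec (fun t a b ra rb =>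
  if t == 4 then (a == x) || (0 < rb) else (t == 5) && (0 < rb)).

Lemma univ_codeE x A : univ_code x (enc A) = univ_bound x A.
Proof.
rewrite /univ_code; elim: A => [|p ts|B IHB C IHC|B IHB C IHC|B IHB C IHC|y B IH|y B IH];
  by rewrite frec_enc /= ?IH //; case: univ_bound.
Qed.

Lemma computable_univ_code a b :
  computable a -> computable b -> computable (fun v => univ_code (a v) (b v)).
Proof. by move=> ca cb; apply: computable_frec => //; computability. Qed.

Lemma univ_exs_alls x xs ys psi :
  qfree psi -> univ_bound x (exs xs (alls ys psi)) = (x \in ys).
Proof.
move=> qf; have -> : univ_bound x (exs xs (alls ys psi)) = univ_bound x (alls ys psi) by elim: xs.
elim: ys => [|y ys IH] /=.
  by case: psi qf.
by rewrite in_cons IH eq_sym.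
Qed.

(* The domain consists of the codes of terms: a constant denotes its own code, as
   does an existential variable of the sentence coded by [n], whereas the values of
   the universal variables are listed by [e]. *)
Definition subst_code (n e d : nat) : nat :=
  if (d %% 2 == 0) && (0 < univ_code (d %/ 2) n) then lnth e (d %/ 2) else d.

(** Truncation by [minn n] confines the arguments to [0, ..., n] and leaves intact the codes of the
    terms in the sentence, all below [n]. *)
Definition ground_code (n e : nat) : nat -> nat :=
  lrec (fun d r => (npair (minn n (subst_code n e d)) r).+1).

Lemma ground_codeE n e ts :
  ground_code n e (enc_terms ts) =
  lcode [seq minn n (subst_code n e (enc_term t)) | t <- ts].
Proof. by rewrite enc_termsE /ground_code lrec_lcode; elim: ts => //= t ts ->. Qed.

Lemma computable_ground_code a b c : computable a -> computable b -> computable c ->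
  computable (fun v => ground_code (a v) (b v) (c v)).
Proof.
move=> ca cb cc; apply: computable_lrec => //; rewrite /subst_code.
by computability_with ltac:(simple apply computable_univ_code).
Qed.

(** [m] codes the table of truth values of the ground atoms, indexed by the codes of these atoms. *)
Definition truth_code (n m e : nat) : nat -> nat := frec (fun t a b ra rb =>
  if t == 6 then false
  else if t == 0 then 0 < lnth m (npair a (ground_code n e b))
  else if t == 1 then (0 < ra) && (0 < rb)
  else if t == 2 then (0 < ra) || (0 < rb)
  else if t == 3 then (0 < ra) ==> (0 < rb)
  else 0 < rb).

Lemma computable_truth_code a b c d :
  computable a -> computable b -> computable c -> computable d ->
  computable (fun v => truth_code (a v) (b v) (c v) (d v)).
Proof.
move=> ca cb cc cd; apply: computable_frec => //.
by computability_with ltac:(simple apply computable_ground_code).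
Qed.

(* On a prenex sentence, this is the truth value of the matrix. *)
Fixpoint beval (prd : nat -> seq term -> bool) (A : formula) : bool :=
  match A with
  | FBot => false
  | Atom p ts => prd p ts
  | FAnd B C => beval prd B && beval prd C
  | FOr B C => beval prd B || beval prd C
  | FImp B C => beval prd B ==> beval prd C
  | FAll _ B | FEx _ B => beval prd B
  end.

Lemma truth_codeE n m e A :
  truth_code n m e (enc A) = beval (fun p ts => 0 < lnth m (npair p
    (lcode [seq minn n (subst_code n e (enc_term t)) | t <- ts]))) A.
Proof.
rewrite /truth_code; elim: A => [|p ts|B IHB C IHC|B IHB C IHC|B IHB C IHC|y B IH|y B IH];
  by rewrite frec_enc /= ?ground_codeE ?IHB ?IHC ?IH ?lt0b.
Qed.

(** The bound on atom codes will keep table lookups within range; the condition on variables lets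
    closedness of the sentence be used. *)
Lemma beval_ext f g A : qfree A ->
  (forall p ts, npair p (enc_terms ts) < enc A ->
     {subset flatten (map term_fv ts) <= fv A} -> f p ts = g p ts) ->
  beval f A = beval g A.
Proof.
elim: A => //= [p ts _ H|B IHB C IHC|B IHB C IHC|B IHB C IHC]; first by apply: H => //; lia.
all: move=> [qB qC] H; have [leB leC] := npair_ge (enc B) (enc C).
all: rewrite IHB ?IHC // => p ts lt sub; apply: H => [|x /sub xin];
  rewrite ?mem_cat ?xin ?orbT //; lia.
Qed.

Lemma beval_exs_alls f xs ys psi : beval f (exs xs (alls ys psi)) = beval f psi.
Proof. by elim: xs => //=; elim: ys. Qed.

(** One more than the largest code of a truncated atom with name at most [n] and at most [n]
    arguments. *)
Definition atom_bound (n : nat) : nat := (npair n (lcode_max n n)).+1.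

(** The tests concern the prefix, closedness and the matrix. The bound for [m] covers all bit tables
    of length [atom_bound n], that for [e] all lists of [n] values up to [n]; [m] is chosen first,
    since one model must serve all assignments. *)
Definition decide (n : nat) : bool :=
  [&& 0 < level_code n,
      all (fun x => ~~ (0 < free_code x n)) (iota 0 n) &
      has (fun m => all (fun e => 0 < truth_code n m e n) (iota 0 (lcode_max n n).+1))
          (iota 0 (lcode_max 1 (atom_bound n)).+1)].

Lemma computable_decide a : computable a -> computable (fun v => decide (a v)).
Proof.
move=> ca; rewrite /decide /atom_bound; computability_with ltac:(first
  [ simple apply computable_level_code | simple apply computable_free_code
  | simple apply computable_truth_code | simple apply computable_all
  | simple apply computable_has ]).
Qed.

(** * Semantics *)

Section Semantics.
Variables (U : Type) (cst : nat -> U) (prd : nat -> seq U -> R).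
Hypothesis prd01 : forall p us, (0 <= prd p us <= 1)%R.

Lemma feval01 e A : (0 <= feval cst prd e A <= 1)%R.
Proof.
elim: A e => [|p ts|B IHB C IHC|B IHB C IHC|B IHB C IHC|x B IH|x B IH] e //=.
- by rewrite lexx ler01.
- have /andP[b0 b1] := IHB e; have /andP[c0 c1] := IHC e.
  by rewrite le_min ge_min b0 c0 b1.
- have /andP[b0 b1] := IHB e; have /andP[c0 c1] := IHC e.
  by rewrite le_max ge_max b0 b1 c1.
- by rewrite /gimp; case: ifP => // _; rewrite ler01 lexx.
- apply/andP; split.
    apply: lb_le_inf => [|_ [u _ <-]]; last by have /andP[] := IH (upd e x u).
    by exists (feval cst prd (upd e x (e x)) B), (e x).
  have /andP[_] := IH (upd e x (e x)); apply: le_trans.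
  apply: ge_inf; last by exists (e x).
  by exists 0%R => _ [u _ <-]; have /andP[] := IH (upd e x u).
- have ub : ubound [set feval cst prd (upd e x u) B | u in setT] 1%R.
    by move=> _ [u _ <-]; have /andP[] := IH (upd e x u).
  apply/andP; split; last by apply: ge_sup => //; exists (feval cst prd (upd e x (e x)) B), (e x).
  have /andP[b0 _] := IH (upd e x (e x)); apply: le_trans b0 _.
  by apply: ub_le_sup; [exists 1%R | exists (e x)].
Qed.

(** For an implication: if the premise is at most the conclusion, the value is 1 and positivity
    passes to the conclusion; otherwise the value is that of the conclusion, and the premise, lying
    above a nonnegative number, is positive. *)
Lemma feval_gt0 e A : qfree A ->
  (0 < feval cst prd e A)%R = beval (fun p ts => (0 < prd p (map (teval cst e) ts))%R) A.
Proof.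
elim: A => [|p ts|B IHB C IHC|B IHB C IHC|B IHB C IHC|x B IH|x B IH] //= q.
- by case: q => qB qC; rewrite lt_min IHB // IHC.
- by case: q => qB qC; rewrite lt_max IHB // IHC.
- case: q => qB qC; rewrite -IHB // -IHC // /gimp.
  have /andP[b0 _] := feval01 e B.
  case: (leP (feval cst prd e B) (feval cst prd e C)) => [le_bc|lt_cb].
    by rewrite ltr01; apply/esym/implyP => /lt_le_trans; apply.
  have -> : (0 < feval cst prd e B)%R.
    by have /andP[c0 _] := feval01 e C; apply: le_lt_trans lt_cb.
  by [].
Qed.

(** The connectives preserve the set of values 0 and 1, on which being positive means being 1. *)
Lemma feval_two_valued e A : (forall p us, prd p us = 0%R \/ prd p us = 1%R) ->
  qfree A -> (0 < feval cst prd e A)%R -> feval cst prd e A = 1%R.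
Proof.
move=> prd2 qA; suff [->|//] : feval cst prd e A = 0%R \/ feval cst prd e A = 1%R.
  by rewrite ltxx.
elim: A qA => [|p ts|B IHB C IHC|B IHB C IHC|B IHB C IHC|x B IH|x B IH] //=; first by left.
- move=> [/IHB IB /IHC IC].
  by case: IB => ->; case: IC => ->; rewrite ?minxx /Num.min ?ltr01 ?ltr10; auto.
- move=> [/IHB IB /IHC IC].
  by case: IB => ->; case: IC => ->; rewrite ?maxxx /Num.max ?ltr01 ?ltr10; auto.
- by move=> [_ /IHC IC]; rewrite /gimp; case: ifP => _; auto.
Qed.

(** If no instance were positive, the supremum would be at most 0. Positivity is traced instead of
    the value 1 because a supremum equal to 1 need not be attained. *)
Lemma exs_gt0 e xs A : (0 < feval cst prd e (exs xs A))%R ->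
  exists e', (forall x, x \notin xs -> e' x = e x) /\ (0 < feval cst prd e' A)%R.
Proof.
elim: xs e => [|x xs IH] e /= pos; first by exists e.
have [u /IH[e' [agree pos']]] : exists u, (0 < feval cst prd (upd e x u) (exs xs A))%R.
  apply: contrapT => no; move: pos; apply/negP; rewrite -leNgt.
  apply: ge_sup => [|_ [u _ <-]].
    by exists (feval cst prd (upd e x (e x)) (exs xs A)), (e x).
  by rewrite leNgt; apply/negP => pu; apply: no; exists u.
exists e'; split=> // y; rewrite in_cons negb_or => /andP[yx /agree ->].
by rewrite /upd (negbTE yx).
Qed.

(** A positive infimum bounds every instance from below. The converse fails, as positive values may
    have infimum 0; the way back therefore works with the value 1. *)
Lemma alls_gt0 e ys A e' : (0 < feval cst prd e (alls ys A))%R ->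
  (forall y, y \notin ys -> e' y = e y) -> (0 < feval cst prd e' A)%R.
Proof.
elim: ys e => [|y ys IH] e /= pos agree.
  by rewrite (_ : e' = e) //; apply: funext => x; apply: agree.
(* Each variable receives its final value at once, so repetitions in [ys] do no harm. *)
apply: (IH (upd e y (e' y))) => [|x xys].
  apply: lt_le_trans pos _; apply: ge_inf; last by exists (e' y).
  by exists 0%R => _ [u _ <-]; have /andP[] := feval01 (upd e y u) (alls ys A).
by rewrite /upd; case: eqP => [->|/eqP xy] //; apply: agree; rewrite in_cons negb_or xy.
Qed.

Lemma exs_eq1 e xs A e' : (forall x, x \notin xs -> e' x = e x) ->
  feval cst prd e' A = 1%R -> feval cst prd e (exs xs A) = 1%R.
Proof.
elim: xs e => [|x xs IH] e /= agree A1.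
  by rewrite (_ : e = e') //; apply: funext => y; rewrite agree.
have /IH/(_ A1) H : forall y, y \notin xs -> e' y = upd e x (e' x) y.
  move=> y yxs; rewrite /upd; case: eqP => [->|/eqP yx] //.
  by apply: agree; rewrite in_cons negb_or yx.
have ub : ubound [set feval cst prd (upd e x u) (exs xs A) | u in setT] 1%R.
  by move=> _ [u _ <-]; have /andP[] := feval01 (upd e x u) (exs xs A).
apply/le_anti/andP; split.
  by apply: ge_sup => //; exists 1%R, (e' x).
by apply: ub_le_sup; [exists 1%R | exists (e' x)].
Qed.

Lemma alls_eq1 e ys A :
  (forall e', (forall y, y \notin ys -> e' y = e y) -> feval cst prd e' A = 1%R) ->
  feval cst prd e (alls ys A) = 1%R.
Proof.
elim: ys e => [|y ys IH] e A1 /=; first exact: A1.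
have H u : feval cst prd (upd e y u) (alls ys A) = 1%R.
  apply: IH => e' agree; apply: A1 => x; rewrite in_cons negb_or => /andP[xy /agree ->].
  by rewrite /upd (negbTE xy).
rewrite (_ : [set _ | _ in _] = [set 1%R])%classic ?inf1 //.
by apply/seteqP; split=> [_ [u _ <-]|_ ->] /=; [rewrite H | exists (e y)].
Qed.

End Semantics.

(** * From models to tables of ground atoms and back *)

Lemma fv_exs_alls x xs ys A :
  (x \in fv (exs xs (alls ys A))) = [&& x \notin xs, x \notin ys & x \in fv A].
Proof.
elim: xs => [|z xs IH] /=; last by rewrite mem_filter IH in_cons negb_or andbA.
by elim: ys => [|y ys IH] //=; rewrite mem_filter IH in_cons negb_or andbA.
Qed.

Lemma lcode_ge s : size s <= lcode s /\ all (fun x => x < lcode s) s.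
Proof.
elim: s => //= x s [IHs IHa]; have [lex les] := npair_ge x (lcode s).
rewrite !ltnS lex (leq_trans IHs) //=; split=> //.
by apply: sub_all IHa => y; lia.
Qed.

Lemma lcode_inj : injective lcode.
Proof.
elim=> [|x s IH] [|y t] //= [] e; congr (_ :: _).
  by rewrite -(fst_npair x (lcode s)) e fst_npair.
by apply: IH; rewrite -(snd_npair x (lcode s)) e snd_npair.
Qed.

Lemma enc_matrix xs ys A : enc A <= enc (exs xs (alls ys A)).
Proof.
elim: xs => [|x xs IH] /=; last by have := npair_ge x (enc (exs xs (alls ys A))); lia.
by elim: ys => [|y ys IH] //=; have := npair_ge y (enc (alls ys A)); lia.
Qed.

Lemma atom_bounds n p ts : npair p (enc_terms ts) < n ->
  [/\ p <= n, size ts <= n & all (fun t => enc_term t < n) ts].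
Proof.
rewrite enc_termsE => lt; have [lep les] := npair_ge p (lcode (map enc_term ts)).
have [sz al] := lcode_ge (map enc_term ts); rewrite size_map in sz.
split; [by lia.. |]; rewrite all_map in al; apply: sub_all al => t /=; lia.
Qed.

Lemma ground_atom_bound n p (f : term -> nat) ts : p <= n -> size ts <= n ->
  npair p (lcode [seq minn n (f t) | t <- ts]) < atom_bound n.
Proof.
move=> pn sn; rewrite ltnS leq_npair // lcode_bound ?size_map // all_map.
by elim: ts {sn} => //= t ts ->; rewrite geq_minl.
Qed.

Lemma eq_map_terms (T : Type) (f g : term -> T) n (xs : seq nat) ts :
  (forall t, enc_term t < n -> {subset term_fv t <= xs} -> f t = g t) ->
  all (fun t => enc_term t < n) ts -> {subset flatten (map term_fv ts) <= xs} ->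
  map f ts = map g ts.
Proof.
move=> fg; elim: ts => //= t ts IH /andP[tn tsn] sub; congr (_ :: _).
  by apply: fg => // x xt; apply: sub; rewrite mem_cat xt.
by apply: IH => // x xt; apply: sub; rewrite mem_cat xt orbT.
Qed.

Lemma subst_code_const n e c : subst_code n e (enc_term (TConst c)) = c.*2.+1.
Proof. by rewrite /subst_code /= (_ : c.*2.+1 %% 2 == 0 = false) //; lia. Qed.

Lemma subst_code_var A e x :
  subst_code (enc A) e (enc_term (TVar x)) = if univ_bound x A then lnth e x else x.*2.
Proof. by rewrite /subst_code /= -muln2 modnMl mulnK //= univ_codeE lt0b. Qed.

Lemma satisfiable_decided (V : set R) xs ys psi :
  goedel_set V -> qfree psi -> one_sat V (exs xs (alls ys psi)) ->
  let n := enc (exs xs (alls ys psi)) in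
  exists2 m, m <= lcode_max 1 (atom_bound n) & forall e, 0 < truth_code n m e n.
Proof.
set A := exs xs (alls ys psi) => -[_ [V01 _]] qf [U [u0 [cst [prd [prdV val1]]]]] n.
have prd01 p us : (0 <= prd p us <= 1)%R by exact: (V01 _ (prdV p us)).
have [e1 [_ e1_gt0]] : exists e1, (forall x, x \notin xs -> e1 x = u0) /\
    (0 < feval cst prd e1 (alls ys psi))%R.
  by apply: (exs_gt0 (e := fun=> u0)); rewrite val1 ltr01.
(* The pull-back map: odd codes go to the constants they name, even ones to the existential
   witnesses. *)
pose phi d := if odd d then cst d./2 else e1 d./2.
(* A classical truth value for every atom code; only the first [atom_bound n] of them enter the
   table. *)
pose chi i := `[< exists p ds, i = npair p (lcode ds) /\ (0 < prd p (map phi ds))%R >].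
have chiE p ds : chi (npair p (lcode ds)) = (0 < prd p (map phi ds))%R.
  apply/asboolP/idP => [[q [es [eq_code]]]|]; last by exists p, ds.
  rewrite -(fst_npair p (lcode ds)) eq_code fst_npair.
  by rewrite (_ : ds = es) //; apply: lcode_inj;
    rewrite -(snd_npair p (lcode ds)) eq_code snd_npair.
exists (lcode (mkseq (fun i => chi i : nat) (atom_bound n))) => [|e].
  rewrite lcode_bound ?size_mkseq // all_map; apply/allP => i _ /=; exact: leq_b1.
(* Whatever [e] is, its truncated entries name elements of [U] through [phi] and so give an instance
   of the universal quantifiers. *)
pose e2 x := if x \in ys then phi (minn n (lnth e x)) else e1 x.
have : (0 < feval cst prd e2 psi)%R.
  by apply: alls_gt0 e1_gt0 _ => // y /negbTE yys; rewrite /e2 yys.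
rewrite truth_codeE beval_exs_alls lt0b feval_gt0 //.
rewrite (@beval_ext _ (fun p ts => 0 < lnth (lcode (mkseq (fun i => chi i : nat) (atom_bound n)))
   (npair p (lcode [seq minn n (subst_code n e (enc_term t)) | t <- ts])))) // => p ts lt _.
have [pn sn tn] := atom_bounds (leq_trans lt (enc_matrix xs ys psi)).
have bound := ground_atom_bound (fun t => subst_code n e (enc_term t)) pn sn.
rewrite lnth_lcode ?size_mkseq // nth_mkseq // lt0b chiE -map_comp.
congr (0 < prd p _)%R; apply: (@eq_map_terms _ _ _ n (flatten (map term_fv ts))) => // t tn' _.
rewrite /=; case: t tn' => [x|c] tn'; last first.
  by rewrite subst_code_const (minn_idPr (ltnW tn')) /phi /= odd_double uphalf_double.
rewrite subst_code_var univ_exs_alls //= /e2; case: ifP => // _.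
by rewrite (minn_idPr (ltnW tn')) /phi /= odd_double doubleK.
Qed.

(** The model has domain [nat], but its predicates see their arguments only through [minn n]. A
    number above [n] thus behaves like [n], and finitely many assignments represent all. *)
Lemma decided_satisfiable (V : set R) xs ys psi m :
  goedel_set V -> qfree psi -> fv (exs xs (alls ys psi)) = [::] ->
  let n := enc (exs xs (alls ys psi)) in
  (forall e, e <= lcode_max n n -> 0 < truth_code n m e n) ->
  one_sat V (exs xs (alls ys psi)).
Proof.
set A := exs xs (alls ys psi) => -[_ [_ [V0 V1]]] qf closedA n truth.
pose prd p us : R := if 0 < lnth m (npair p (lcode (map (minn n) us))) then 1%R else 0%R.
have prd01 p us : (0 <= prd p us <= 1)%R by rewrite /prd; case: ifP; rewrite ?lexx ?ler01.
exists nat, 0, (fun c => c.*2.+1), prd; split.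
  by move=> p us; rewrite /prd; case: ifP.
(* An existential variable denotes its own code, as in [subst_code]; other variables keep the
   default element 0. *)
pose e1 x := if x \in xs then x.*2 else 0.
apply: (exs_eq1 prd01 (e' := e1)) => [x /negbTE xxs|]; first by rewrite /e1 xxs.
apply: alls_eq1 => e2 agree; apply: feval_two_valued => //.
  by move=> p us; rewrite /prd; case: ifP; auto.
(* An arbitrary assignment is represented by its truncation on the variables below [n], among which
   are those of [psi]. *)
pose e := lcode (mkseq (fun x => minn n (e2 x)) n).
have /truth : e <= lcode_max n n.
  rewrite lcode_bound ?size_mkseq // all_map; apply/allP => i _ /=; exact: geq_minl.
rewrite truth_codeE beval_exs_alls lt0b feval_gt0 //.
rewrite (@beval_ext _ (fun p ts => (0 < prd p (map (teval (fun c => c.*2.+1) e2) ts))%R)) //.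
move=> p ts lt sub.
have [pn sn tn] := atom_bounds (leq_trans lt (enc_matrix xs ys psi)).
transitivity (0 < lnth m (npair p
    (lcode (map (minn n) (map (teval (fun c => c.*2.+1) e2) ts))))); last first.
  by rewrite /prd; case: ifP; rewrite ?ltr01 ?ltxx.
rewrite -map_comp; congr (0 < lnth m (npair p (lcode _))).
apply: (@eq_map_terms _ _ _ n (fv psi)) => // -[x|c] tn' xpsi /=; last by rewrite subst_code_const.
have xn : x < n by move: tn' => /=; lia.
rewrite subst_code_var univ_exs_alls //; case: ifP => xys.
  by rewrite /e lnth_lcode ?size_mkseq // nth_mkseq // minnA minnn.
rewrite agree ?xys // /e1; case: ifP => // xxs.
(* A variable of [psi] outside both [xs] and [ys] would be free in the sentence. *)
have : x \in fv A by rewrite fv_exs_alls xxs xys xpsi // mem_seq1.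
by rewrite closedA.
Qed.

(** Makes the search for free variables below the code exhaustive; it holds because a pair is never
    smaller than its components. *)
Lemma fv_lt_enc A x : x \in fv A -> x < enc A.
Proof.
elim: A => //= [p ts|B IHB C IHC|B IHB C IHC|B IHB C IHC|y B IH|y B IH].
- have [lep les] := npair_ge p (enc_terms ts).
  suff : x \in flatten (map term_fv ts) -> x <= enc_terms ts by move=> H /H; lia.
  elim: ts {lep les} => //= t ts IH; rewrite mem_cat => /orP[xt|/IH].
    have [let_ _] := npair_ge (enc_term t) (enc_terms ts); move: xt let_.
    by case: t => //= y; rewrite mem_seq1 => /eqP ->; lia.
  by have := npair_ge (enc_term t) (enc_terms ts); lia.
- by have := npair_ge (enc B) (enc C); rewrite mem_cat => le /orP[/IHB|/IHC]; lia.
- by have := npair_ge (enc B) (enc C); rewrite mem_cat => le /orP[/IHB|/IHC]; lia.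
- by have := npair_ge (enc B) (enc C); rewrite mem_cat => le /orP[/IHB|/IHC]; lia.
- by have := npair_ge y (enc B); rewrite mem_filter => le /andP[_ /IH]; lia.
- by have := npair_ge y (enc B); rewrite mem_filter => le /andP[_ /IH]; lia.
Qed.

Lemma decideP (V : set R) A : goedel_set V ->
  decide (enc A) <-> BS A /\ one_sat V A.
Proof.
move=> gV; rewrite /decide level_codeE.
have closedP : all (fun x => ~~ (0 < free_code x (enc A))) (iota 0 (enc A)) <-> sentence A.
  rewrite /sentence; split=> [/allP nofree|fv0]; last first.
    by apply/allP => x _; rewrite free_codeE fv0.
  apply/nilP; rewrite /nilp -leqn0 leqNgt -has_predT; apply/hasP => -[x xA _].
  by have := nofree x; rewrite mem_iota fv_lt_enc // free_codeE xA => /(_ isT).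
split.
  case/and3P => /level_BS[xs [ys [psi [qf AE]]]] /closedP clA /hasP[m _ /allP truth].
  split; first by split=> //; exists xs, ys, psi.
  rewrite AE; apply: (@decided_satisfiable _ _ _ _ m) => //; rewrite -?AE // => e le_e.
  by apply: truth; rewrite mem_iota.
case=> -[clA [xs [ys [psi [qf AE]]]]] sat.
have := @satisfiable_decided V xs ys psi gV qf; rewrite -AE => /(_ sat)[m le_m truth].
apply/and3P; split; [by apply/level_BS; exists xs, ys, psi | exact/closedP |].
apply/hasP; exists m; first by rewrite mem_iota.
by apply/allP => e _.
Qed.

(* For every Goedel set V, the set of (Goedel numbers of) BS sentences that
   are 1-satisfiable in G_V is decidable. *)
Theorem theorem3 (V : set R) (hV : goedel_set V) :
  decidable_nat (fun n => exists A : formula, enc A = n /\ BS A /\ one_sat V A).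
Proof.
have [c cE] := computable_decide (computable_nth 0) 1.
exists c => n; have := cE [:: n] erefl; rewrite /= => cn.
(* The negative case supplies no formula, so surjectivity of the coding provides the one coded by
   [n]. *)
have [A EA] := enc_surj n; split=> [[B [EB /(decideP _ hV) dB]]|no].
  by move: cn; rewrite -EB dB.
suff /negbTE dn : ~~ decide n by rewrite dn in cn.
by apply/negP; rewrite -EA => /(decideP _ hV) satA; apply: no; exists A.
Qed.
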